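(* Let $R$ be a left perfect ring. Then $\{\mathscr{P}_\sigma\mid\sigma \text{ is a } t\text{-radical on } R\text{-Mod}\}=R\text{-conat}$.
   Context: $R$ is an associative ring with identity; modules are left $R$-modules. A preradical on $R\text{-Mod}$ is a functor $\sigma:R\text{-Mod}\to R\text{-Mod}$ with $\sigma(M)\le M$ for all $M$ and $f(\sigma(M))\le\sigma(N)$ for every homomorphism $f:M\to N$ ($\sigma(f)$ being the restriction of $f$). $\sigma$ is a $t$-radical if $\sigma(M)=\sigma(R)M$ for every module $M$. $\mathbb{T}_\sigma=\{M\mid\sigma(M)=M\}$. $\mathscr{P}_\sigma$ is the class of all modules $M$ having no nonzero quotient in $\mathbb{T}_\sigma$ (the zero module is included). For a class $\mathscr{D}$ of modules closed under quotients, $\mathscr{D}^{\perp_\twoheadrightarrow}$ is the class of all modules having no nonzero quotient in $\mathscr{D}$. $R\text{-conat}$ is the collection of conatural classes, i.e. classes of the form $\mathscr{D}^{\perp_\twoheadrightarrow}$ with $\mathscr{D}$ a class of modules closed under quotients. $R$ is left perfect if every left $R$-module has a projective cover. *)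

(* Defs.v *)
From mathcomp Require Import all_boot all_algebra.
From mathcomp Require Import boolp classical_sets.
Set Implicit Arguments.
Unset Strict Implicit.
Unset Printing Implicit Defensive.
Import GRing.Theory.
Local Open Scope classical_set_scope.
Local Open Scope ring_scope.

(* The zero ring is an associative ring with identity, hence pzRingType. *)

Definition submodule (R : pzRingType) (M : lmodType R) (A : set M) : Prop :=
  submod_closed [in A].

Definition zero_module (R : pzRingType) (M : lmodType R) : Prop :=
  forall x : M, x = 0.

(* A quotient of M is, up to isomorphism, the codomain of a surjective linear
   map out of M; all classes of modules below are thus isomorphism-closed. *)
Definition epi (R : pzRingType) (M N : lmodType R) (f : {linear M -> N}) :
  Prop := range f = setT.

Definition projective (R : pzRingType) (P : lmodType R) : Prop :=
  forall (M N : lmodType R) (g : {linear M -> N}) (h : {linear P -> N}),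
    epi g -> exists k : {linear P -> M}, forall x, g (k x) = h x.

Definition superfluous (R : pzRingType) (M : lmodType R) (K : set M) : Prop :=
  forall L : set M, submodule L ->
    [set k + l | k in K & l in L] = setT -> L = setT.

Definition projective_cover (R : pzRingType) (P M : lmodType R)
    (p : {linear P -> M}) : Prop :=
  [/\ projective P, epi p & superfluous (p @^-1` [set 0])].

Definition left_perfect (R : pzRingType) : Prop :=
  forall M : lmodType R,
    exists (P : lmodType R) (p : {linear P -> M}), projective_cover p.

(* [set (lmodType R)] would be a universe inconsistency. *)
Definition module_class (R : pzRingType) : Type := lmodType R -> Prop.

Definition quotient_closed (R : pzRingType) (D : module_class R) : Prop :=
  forall (M N : lmodType R) (f : {linear M -> N}), epi f -> D M -> D N.

Definition quotient_perp (R : pzRingType) (D : module_class R) :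
    module_class R :=
  fun M => forall (N : lmodType R) (f : {linear M -> N}),
    epi f -> D N -> zero_module N.

Definition preradical (R : pzRingType) (sigma : forall M : lmodType R, set M) :
    Prop :=
  (forall M : lmodType R, submodule (sigma M)) /\
  (forall (M N : lmodType R) (f : {linear M -> N}),
     f @` sigma M `<=` sigma N).

(* The submodule I M of all finite sums of products a m with a in I. *)
Definition ideal_mul (R : pzRingType) (I : set R) (M : lmodType R) : set M :=
  [set x | exists (n : nat) (a : 'I_n -> R) (m : 'I_n -> M),
     (forall i, I (a i)) /\ x = \sum_(i < n) a i *: m i].
Arguments ideal_mul {R} I M.

Definition t_radical (R : pzRingType) (sigma : forall M : lmodType R, set M) :
    Prop :=
  preradical sigma /\
  forall M : lmodType R, sigma M = @ideal_mul R (sigma R^o) M.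

Definition T_class (R : pzRingType) (sigma : forall M : lmodType R, set M) :
    module_class R :=
  fun M => sigma M = setT.

Definition P_class (R : pzRingType) (sigma : forall M : lmodType R, set M) :
    module_class R :=
  quotient_perp (T_class sigma).

Definition same_class (R : pzRingType) (C D : module_class R) : Prop :=
  forall M : lmodType R, C M <-> D M.

Definition conatural (R : pzRingType) (C : module_class R) : Prop :=
  exists D : module_class R,
    quotient_closed D /\ same_class C (quotient_perp D).

(* Main.v *)
From HB Require Import structures.
Require Import Defs.
From mathcomp Require Import all_boot all_algebra.
From mathcomp Require Import boolp classical_sets functions.
Set Implicit Arguments.
Unset Strict Implicit.
Unset Printing Implicit Defensive.
From mathcomp Require Import generic_quotient ring_quotient.
Import GRing.Theory.
Local Open Scope classical_set_scope.
Local Open Scope ring_scope.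
Local Open Scope quotient_scope.

(** The classes in play are those of the form D^perp, with D closed under
quotients, on one side, and the classes P_sigma on the other. For any
preradical sigma the class of all M with sigma(M) = M is closed under
quotients, so every P_sigma is conatural. The content is the converse: given a
quotient-closed D, find a two-sided ideal I such that the modules with
I M = M have the same perp as D; then sigma(M) = I M is the required t-radical.

Over a left perfect ring every nonzero module has a simple quotient
([left_perfect_simple_quotient]). Hence D^perp only depends on the simple
modules in D ([quotient_perp_determined_by_simples]), and it is enough that
I S = S holds for the simple modules S in D and for no others. Take for I the
common annihilator of the simple modules outside D. It kills those by
definition. A simple S in D has a projective cover P, which is generated by one
element and so is a direct summand of R; the unique simple quotient of P is S,
so no simple module outside D receives a nonzero map from P, and therefore the
copy of P in R lies in I. It acts nontrivially on S, whence I S = S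
([annihilator_outside_fixes]).

It remains to produce simple quotients. A module M has the same simple
quotients as its projective cover, because a nonzero map from P to a simple
module kills any superfluous submodule
([simple_quotient_of_projective_cover]). So the point is that a projective
module P without simple quotients is zero, which is Bass's theorem that
a nonzero projective module differs from its radical. In terms of a dual basis,
all coordinates of all elements of P lie in the Jacobson radical J, since
otherwise a coordinate would give a nonzero map from P to a simple module.
Expanding the elements of the dual basis occurring in x in terms of
each other shows that the row r of coordinates of x satisfies r = r A with A a
square matrix over J, and Nakayama's lemma gives r = 0. *)

(** * Linear maps, submodules and quotients *)

Lemma submoduleP (R : pzRingType) (M : lmodType R) (A : set M) :
  submodule A <-> A 0 /\ forall a x y, A x -> A y -> A (a *: x + y).
Proof.
split=> [[A0 AZ]|[A0 AZ]]; split; rewrite ?inE //.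
- by move: A0; rewrite inE.
- by move=> a x y Ax Ay; move: (AZ a x y); rewrite !inE; exact.
- by move=> a x y; rewrite !inE; exact: AZ.
Qed.

Lemma ex_linear (R : pzRingType) (M N : lmodType R) (f : M -> N) :
  (forall a x y, f (a *: x + y) = a *: f x + f y) ->
  exists g : {linear M -> N}, forall x, g x = f x.
Proof.
move=> flin; pose fL := GRing.isLinear.Build R M N *:%R f flin.
by exists (HB.pack_for {linear M -> N} f fL).
Qed.

Lemma epiP (R : pzRingType) (M N : lmodType R) (f : {linear M -> N}) :
  epi f <-> forall y, exists x, f x = y.
Proof.
split=> fT; last first.
  by rewrite /epi -subTset => y _; have [x <-] := fT y; exists x.
move=> y; have [x _ <-] : range f y by rewrite fT.
by exists x.
Qed.

(** The closure proof is an argument so that the canonical submodule structure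
can be attached to the predicate. *)
Definition carrier (R : pzRingType) (M : lmodType R) (A : set M)
  (hA : submodule A) : {pred M} := [in A].

HB.instance Definition _ (R : pzRingType) (M : lmodType R) (A : set M)
    (hA : submodule A) :=
  GRing.isSubmodClosed.Build R M (carrier hA) (GRing.submod_closed_semi hA).

Definition submodule_sort (R : pzRingType) (M : lmodType R) (A : set M)
  (hA : submodule A) : Type := {x : M | carrier hA x}.

HB.instance Definition _ (R : pzRingType) (M : lmodType R) (A : set M)
  (hA : submodule A) := SubChoice.on (submodule_sort hA).
HB.instance Definition _ (R : pzRingType) (M : lmodType R) (A : set M)
  (hA : submodule A) := [SubChoice_isSubLmodule of submodule_sort hA by <:].

Lemma ex_submodule (R : pzRingType) (M : lmodType R) (A : set M) :
  submodule A ->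
  exists (N : lmodType R) (i : {linear N -> M}), injective i /\ range i = A.
Proof.
move=> hA; exists (submodule_sort hA).
exists (val : {linear submodule_sort hA -> M}); split; first exact: val_inj.
apply/seteqP; split=> [_ [x _ <-]|x Ax]; first by have := valP x; rewrite inE.
have xA : carrier hA x by rewrite /carrier inE.
by exists (Sub x xA : submodule_sort hA); rewrite //= SubK.
Qed.


Lemma ex_quotient (R : pzRingType) (M : lmodType R) (A : set M) :
  submodule A ->
  exists (N : lmodType R) (f : {linear M -> N}),
    epi f /\ forall x, f x = 0 <-> A x.
Proof.
move=> hA; have [A0 AZ] := (submoduleP A).1 hA.
pose Q := Quotient.quot (carrier hA).
have piE (x y : M) : \pi_Q x = \pi_Q y <-> A (x - y).
  have E := Quotient.idealrBE (carrier hA) x y.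
  rewrite -[A (x - y)]in_setE -/(carrier hA) -[_ \in A]/(_ \in carrier hA) E.
  by split=> /eqP.
have [scale scaleE] : exists scale : R -> Q -> Q,
    forall a x, scale a (\pi_Q x) = \pi_Q (a *: x).
  exists (fun a q => \pi_Q (a *: repr q)) => a x.
  apply/piE; rewrite -scalerBr -[a *: _]addr0; apply: (AZ) => //.
  by apply/piE; rewrite reprK.
have piD x y : \pi_Q (x + y) = \pi_Q x + \pi_Q y by rewrite raddfD.
have scaleA a b q : scale a (scale b q) = scale (a * b) q.
  by elim/quotW: q => x; rewrite !scaleE scalerA.
have scale1 : left_id 1 scale.
  by elim/quotW=> x; rewrite scaleE scale1r.
have scaleDr : right_distributive scale +%R.
  by move=> a; elim/quotW=> x; elim/quotW=> y; rewrite -piD !scaleE scalerDr piD.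
have scaleDl q : {morph scale^~ q : a b / a + b}.
  by elim/quotW: q => x a b; rewrite !scaleE scalerDl piD.
pose N : lmodType R := HB.pack_for (lmodType R) Q
  (GRing.Zmodule_isLmodule.Build R Q scaleA scale1 scaleDr scaleDl).
have [f fE] : exists f : {linear M -> N}, forall x, f x = \pi_Q x.
  apply: ex_linear => a x y; rewrite piD -scaleE.
  by [].
exists N, f; split=> [|x].
  by apply/epiP=> q; exists (repr (q : Q)); rewrite fE reprK.
rewrite fE -[X in A X]subr0 -piE.
by rewrite raddf0.
Qed.

(** * Simple modules *)

(** Equivalent to being nonzero without proper nonzero submodules; the form
used here needs no quantification over submodules. *)
Definition simple_module (R : pzRingType) (S : lmodType R) : Prop :=
  (exists s : S, s <> 0) /\ forall s t : S, s <> 0 -> exists a, t = a *: s.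

Lemma nonzero_map_to_simple_epi (R : pzRingType) (M S : lmodType R)
    (g : {linear M -> S}) (x : M) :
  simple_module S -> g x <> 0 -> epi g.
Proof.
move=> [_ Ssim] gx; apply/epiP => t; have [a ->] := Ssim _ t gx.
by exists (a *: x); rewrite linearZ.
Qed.

(** Zorn's lemma gives a submodule maximal among those not containing the
generator; the quotient by it is simple. *)
Lemma cyclic_simple_quotient (R : pzRingType) (N : lmodType R) (u : N) :
  u <> 0 -> (forall t, exists a, t = a *: u) ->
  exists (S : lmodType R) (f : {linear N -> S}), simple_module S /\ epi f.
Proof.
move=> u0 Nu.
(* 0 is not required to be in A, so that the empty chain has an upper bound;
   a maximal A contains 0 anyway. *)
have [F FP Ftot|A [[AZ Au] Amax]] := @Zorn_bigcup N
  (fun A => (forall a x y, A x -> A y -> A (a *: x + y)) /\ ~ A u).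
  split=> [a x y [X FX Xx] [Y FY Yy]|[X FX Xu]]; last by have [_] := FP _ FX.
  have [XY|YX] := Ftot _ _ FX FY.
    by exists Y => //; apply: (FP _ FY).1 => //; apply: XY.
  by exists X => //; apply: (FP _ FX).1 => //; apply: YX.
have A0 : A 0.
  apply: contrapT => nA0; apply: (Amax [set 0]); last first.
    by split=> [a _ _ -> ->|//]; rewrite scaler0 addr0.
  split=> [x Ax|/(_ 0 erefl)//]; exfalso; apply: nA0.
  by have := AZ (-1) _ _ Ax Ax; rewrite scaleN1r addNr.
have [S [f [fT fA]]] := ex_quotient ((submoduleP A).2 (conj A0 AZ)).
exists S, f; split=> //; split; first by exists (f u) => /fA.
have fP := (epiP f).1 fT.
move=> s t; have [x <-] := fP s; have [y <-] := fP t => fx.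
(* B = R x + A is strictly larger than A, so it contains u. *)
pose B := [set z | exists a l, A l /\ z = a *: x + l].
have [a [l [Al uE]]] : B u.
  apply: contrapT => nBu; apply: (Amax B).
    split=> [l Al|BA]; first by exists 0, l; rewrite scale0r add0r.
    by apply/fx/fA/BA; exists 1, 0; rewrite scale1r addr0.
  split=> // b _ _ [c [l [Al ->]]] [d [m [Am ->]]].
  exists (b * c + d), (b *: l + m); split; first exact: AZ.
  by rewrite scalerDr scalerA scalerDl addrACA.
have [b ->] := Nu y; exists (b * a).
by rewrite uE linearZ linearD linearZ /= ((fA l).2 Al) addr0 scalerA.
Qed.

(** * Nakayama's lemma over the Jacobson radical *)

Definition jacobson_radical (R : pzRingType) : set R :=
  [set a | forall (S : lmodType R) (s : S), simple_module S -> a *: s = 0].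

(** Otherwise R / R(1 - a) is nonzero and cyclic, so it has a simple quotient S.
In S the image s of 1 satisfies s = a s, and a s = 0, although s generates S. *)
Lemma jacobson_left_inverse (R : pzRingType) (a : R) :
  jacobson_radical a -> exists u, u * (1 - a) = 1.
Proof.
move=> Ja; apply: contrapT => nu.
pose L : set R^o := [set r | exists u : R, r = u * (1 - a)].
have hL : submodule L.
  apply/submoduleP; split; first by exists 0; rewrite mul0r.
  by move=> b _ _ [u ->] [v ->]; exists (b * u + v); rewrite mulrDl -mulrA.
have [N [f [fT fL]]] := ex_quotient hL.
have fE (r : R) : f r = r *: f 1 by rewrite -linearZ /= [_ *: _]mulr1.
have f1 : f 1 <> 0 by move/fL => [u uE]; apply: nu; exists u.
have [t|S [g [Ssim gT]]] := cyclic_simple_quotient f1.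
  by have [r <-] := (epiP f).1 fT t; exists r.
have s0 : g (f 1) = 0.
  have : (1 - a) *: g (f 1) = 0.
    rewrite -linearZ -fE (fL _).2 ?linear0 //.
    by exists 1; rewrite mul1r.
  by rewrite scalerBl scale1r (Ja _ _ Ssim) subr0.
have [[s s1] _] := Ssim; apply: s1.
have [n <-] := (epiP g).1 gT s; have [r <-] := (epiP f).1 fT n.
by rewrite fE linearZ /= s0 scaler0.
Qed.

(** A left inverse u of 1 - a is 1 + u a, and u a is again in the radical, so u
has a left inverse as well and is therefore a unit. *)
Lemma jacobson_right_inverse (R : pzRingType) (a : R) :
  jacobson_radical a -> exists v, (1 - a) * v = 1.
Proof.
move=> Ja; have [u uE] := jacobson_left_inverse Ja; exists u.
have [|v] := @jacobson_left_inverse R (- (u * a)).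
  by move=> S s Ssim; rewrite scaleNr -scalerA Ja // scaler0 oppr0.
have -> : 1 - - (u * a) = u by rewrite opprK -[in 1 + _]uE mulrBr mulr1 subrK.
move=> vu; suff <- : v = 1 - a by [].
by rewrite -[LHS]mulr1 -[in LHS]uE mulrA vu mul1r.
Qed.

(** The matrix 1 - A is right invertible. Gaussian elimination by induction:
1 - A_00 being invertible, the equation of index 0 expresses r_0 in terms of
the other r_i, and substituting it leaves a system of the same kind. *)
Lemma nakayama_matrix (R : pzRingType) (n : nat) (r : 'I_n -> R)
    (A : 'I_n -> 'I_n -> R) :
  (forall i j, jacobson_radical (A i j)) ->
  (forall j, r j = \sum_(i < n) r i * A i j) -> forall j, r j = 0.
Proof.
elim: n => [|n IHn] in r A * => JA rA; first by case.
have [v vE] := jacobson_right_inverse (JA ord0 ord0).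
have r0E : r ord0 = \sum_(i < n) r (lift ord0 i) * (A (lift ord0 i) ord0 * v).
  rewrite -[LHS]mulr1 -vE mulrA mulrBr mulr1 {1}rA big_ord_recl addrAC subrr.
  by rewrite add0r mulr_suml; apply: eq_bigr => i _; rewrite mulrA.
have rS j : r (lift ord0 j) = 0.
  apply: (IHn (r \o lift ord0) (fun i j => A (lift ord0 i) ord0 * v
    * A ord0 (lift ord0 j) + A (lift ord0 i) (lift ord0 j))) => [i k S s Ssim|k].
    by rewrite scalerDl -!scalerA !JA // addr0.
  rewrite /= rA big_ord_recl r0E mulr_suml -big_split /=.
  by apply: eq_bigr => i _; rewrite mulrDr !mulrA.
move=> j; case: (unliftP ord0 j) => [k ->|->]; first exact: rS.
by rewrite r0E big1 // => i _; rewrite rS mul0r.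
Qed.

(** * Projective modules and projective covers *)

(** Splitting the surjection onto P from the free module on the set P gives the
coordinates phi p. The free module is realised as the submodule A of
(P -> R) x P of all pairs (f, x) where f is a finitely supported family of
coefficients and x the linear combination of elements of P that it encodes; the
surjection is then the second projection. A list of coefficient-vector pairs,
possibly with repeated vectors, witnesses the finite support. *)
Lemma dual_basis (R : pzRingType) (P : lmodType R) :
  projective P ->
  exists phi : P -> {linear P -> R^o},
    forall x, exists s : seq P, x = \sum_(p <- s) (phi p x : R) *: p.
Proof.
move=> Pproj.
pose A : set ((P -> R^o) * P)%type := [set fx | exists s : seq (R * P),
  (forall y, fx.1 y = \sum_(c <- s | c.2 == y) c.1) /\
  fx.2 = \sum_(c <- s) c.1 *: c.2].
have hA : submodule A.
  apply/submoduleP; split.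
    by exists [::]; split=> [y|]; rewrite big_nil.
  move=> a [f x] [g y] [s [/= fs xs]] [t [/= gt yt]].
  exists ([seq (a * c.1, c.2) | c <- s] ++ t); split=> [z|/=].
    rewrite big_cat big_map /= -gt -mulr_sumr -fs.
    by [].
  rewrite big_cat big_map /= xs yt scaler_sumr.
  by congr (_ + _); apply: eq_bigr => c _; rewrite scalerA.
have [N [i [_ iA]]] := ex_submodule hA.
have Ai n : A (i n) by rewrite -iA; exists n.
pose g : {linear N -> P} := snd \o i.
have gT : epi g.
  apply/epiP => x.
  have : A (fun y => if x == y then 1 else 0, x).
    exists [:: (1, x)]; split=> [y|] /=; last by rewrite big_seq1 scale1r.
    by rewrite big_mkcond big_seq1.
  by rewrite -iA => -[n _ nE]; exists n; rewrite /g /= nE.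
have [k kE] := Pproj _ _ g (idfun : {linear P -> P}) gT.
have /choice[phi phiE] : forall p, exists h : {linear P -> R^o},
    forall x, h x = (i (k x)).1 p.
  by move=> p; apply: ex_linear => a x y; rewrite !linearP.
exists phi => x; have [s [fs xs]] := Ai (k x).
exists (undup [seq c.2 | c <- s]).
have := kE x; rewrite /g /= => kx; rewrite -{1}kx xs.
under [RHS]eq_bigr do rewrite phiE fs scaler_suml big_mkcond.
rewrite exchange_big /= big_seq [RHS]big_seq; apply: eq_bigr => c cs.
rewrite (bigD1_seq c.2) ?undup_uniq //=; last first.
  by rewrite mem_undup map_f.
by rewrite eqxx big1 ?addr0 // => p; rewrite eq_sym => /negPf->.
Qed.

(** Bass's theorem that a nonzero projective module has a simple quotient. *)
Lemma projective_no_simple_quotient_zero (R : pzRingType) (P : lmodType R) :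
  projective P ->
  (forall (S : lmodType R) (g : {linear P -> S}) x,
     simple_module S -> g x = 0) -> zero_module P.
Proof.
move=> /dual_basis[phi phiE] noS x.
have Jphi p y : @jacobson_radical R (phi p y).
  move=> S s Ssim.
  have [g <-] : exists g : {linear P -> S}, forall z, g z = (phi p z : R) *: s.
    apply: ex_linear => a z t.
    by rewrite linearP scalerDl -scalerA.
  exact: noS.
(* With x = sum_j phi_j(x) s_j, applying phi_j to this equation gives
   phi_j(x) = sum_i phi_i(x) phi_j(s_i). *)
have [s sE] := phiE x; rewrite sE (big_nth 0) big_mkord.
apply: big1 => j _.
rewrite (_ : phi _ x = 0) ?scale0r //.
apply: (@nakayama_matrix R (size s) (fun j => phi s`_j x)
  (fun i j => phi s`_j s`_i)) => // {}j.
rewrite {1}sE (big_nth 0) big_mkord linear_sum.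
by apply: eq_bigr => i _; rewrite linearZ.
Qed.

(** If k in ker p had g k <> 0, then R k + ker g would be P, since g k generates
S; ker p being superfluous, this would force g = 0. So g factors through p. *)
Lemma simple_quotient_of_projective_cover (R : pzRingType) (P M S : lmodType R)
    (p : {linear P -> M}) (g : {linear P -> S}) (x : P) :
  projective_cover p -> simple_module S -> g x <> 0 ->
  exists h : {linear M -> S}, epi h.
Proof.
move=> [_ pT psup] Ssim gx; have /choice[s sE] := (epiP p).1 pT.
have kpg k : p k = 0 -> g k = 0.
  move=> pk; apply: contrapT => gk; apply: gx.
  suff kg : g @^-1` [set 0] = setT.
    by have : (g @^-1` [set 0]) x by rewrite kg.
  apply: psup.
    apply/submoduleP; split; first exact: linear0.
    by move=> a y z /= gy gz; rewrite linearP gy gz scaler0 addr0.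
  rewrite -subTset => y _; have [a aE] := Ssim.2 _ (g y) gk.
  exists (a *: k); first by rewrite /= linearZ /= pk scaler0.
  exists (y - a *: k); last by rewrite addrC subrK.
  by rewrite /= linearB linearZ /= aE subrr.
have gsp y : g (s (p y)) = g y.
  by apply/eqP; rewrite -subr_eq0 -linearB kpg // linearB /= sE subrr.
have [|h hE] := @ex_linear R M S (g \o s).
  move=> a y z /=; rewrite -linearP -[LHS]gsp -[RHS]gsp.
  by rewrite sE linearP !sE.
exists h; apply: (@nonzero_map_to_simple_epi R M S h (p x)) => //.
by rewrite hE /= gsp.
Qed.

(** * Conatural classes over a left perfect ring *)

Lemma left_perfect_simple_quotient (R : pzRingType) (M : lmodType R) :
  left_perfect R -> ~ zero_module M ->
  exists (S : lmodType R) (f : {linear M -> S}), simple_module S /\ epi f.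
Proof.
move=> hR M0; have [P [p cp]] := hR M; have [Pproj pT _] := cp.
apply: contrapT => noS; apply: M0 => m.
have [x <-] := (epiP p).1 pT m.
rewrite (projective_no_simple_quotient_zero Pproj _ x) ?linear0 // => S g y Ssim.
apply: contrapT => gy; apply: noS.
by have [h hT] := simple_quotient_of_projective_cover cp Ssim gy; exists S, h.
Qed.

(** A nonzero quotient in E has a simple quotient, which lies in E, hence in D. *)
Lemma quotient_perp_determined_by_simples (R : pzRingType)
    (D E : module_class R) :
  left_perfect R -> quotient_closed E ->
  (forall S : lmodType R, simple_module S -> E S -> D S) ->
  forall M : lmodType R, quotient_perp D M -> quotient_perp E M.
Proof.
move=> hR Eq ED M DM N f fT EN; apply: contrapT => N0.
have [S [g [Ssim gT]]] := left_perfect_simple_quotient hR N0.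
have [[s s0] _] := Ssim; apply: s0.
apply: (DM S (g \o f)); last exact/ED/(Eq _ _ _ gT).
apply/epiP => t; have [n <-] := (epiP g).1 gT t.
by have [m <-] := (epiP f).1 fT n; exists m.
Qed.

Definition annihilator_outside (R : pzRingType) (D : module_class R) : set R :=
  [set r | forall (S : lmodType R) (s : S),
     simple_module S -> ~ D S -> r *: s = 0].

(** The cover P of S is generated by any preimage x of s, so it is a direct
summand of R through a section k of r |-> r x; in fact k x is an idempotent e
with P isomorphic to R e. If k x did not kill some s' in a simple module S'
outside D, then y |-> k(y) s' would make S' a quotient of P, hence of S,
and S' would be in D. *)
Lemma annihilator_outside_fixes (R : pzRingType) (D : module_class R)
    (S : lmodType R) (s : S) :
  left_perfect R -> quotient_closed D -> simple_module S -> D S -> s <> 0 ->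
  exists2 r, annihilator_outside D r & r *: s = s.
Proof.
move=> hR Dq Ssim DS s0; have [P [p cp]] := hR S; have [Pproj pT psup] := cp.
have [x px] := (epiP p).1 pT s.
have [q qE] : exists q : {linear R^o -> P}, forall r, q r = r *: x.
  by apply: ex_linear => a b c; rewrite scalerDl -scalerA.
(* As s generates S, the image of q and ker p together span P. *)
have qT : epi q.
  apply: psup.
    apply/submoduleP; split; first by exists 0; rewrite ?linear0.
    by move=> a _ _ [b _ <-] [c _ <-]; exists (a *: b + c); rewrite ?linearP.
  rewrite -subTset => y _; have [a aE] := Ssim.2 _ (p y) s0.
  exists (y - q a); first by rewrite /= linearB /= qE linearZ /= aE px subrr.
  by exists (q a); rewrite ?subrK //; exists a.
have [k kE] := Pproj _ _ q (idfun : {linear P -> P}) qT.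
exists (k x); last by rewrite -{1}px -linearZ -qE kE.
move=> S' s' S'sim nDS'.
have [g gE] : exists g : {linear P -> S'}, forall y, g y = (k y : R) *: s'.
  by apply: ex_linear => a y z; rewrite linearP scalerDl -scalerA.
apply: contrapT; rewrite -gE => gx; apply: nDS'.
have [h hT] := simple_quotient_of_projective_cover cp S'sim gx.
exact: Dq hT DS.
Qed.

(** * The t-radical of an ideal *)

Lemma ideal_mul_submodule (R : pzRingType) (I : set R^o) (M : lmodType R) :
  submodule I -> submodule (@ideal_mul R I M).
Proof.
move=> /submoduleP[I0 IZ]; apply/submoduleP; split.
  exists 0%N, (fun=> 0), (fun=> 0); split; first by case.
  by rewrite big_ord0.
move=> c _ _ [n [a [m [Ia ->]]]] [n' [a' [m' [Ia' ->]]]].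
exists (n + n')%N.
exists (fun i => match fintype.split i with inl j => c * a j | inr j => a' j end).
exists (fun i => match fintype.split i with inl j => m j | inr j => m' j end).
split=> [i|].
  case: (fintype.split i) => j //; rewrite -[c * a j]addr0; exact: IZ.
rewrite big_split_ord scaler_sumr /=; congr (_ + _); apply: eq_bigr => i _.
  by rewrite (unsplitK (inl i)) scalerA.
by rewrite (unsplitK (inr i)).
Qed.

Lemma ideal_mul_t_radical (R : pzRingType) (I : set R) :
  submodule (I : set R^o) -> (forall a b, I a -> I (a * b)) ->
  t_radical (@ideal_mul R I).
Proof.
move=> hI Ir; split; first split=> [M|M N f _ [_ [n [a [m [Ia ->]]]] <-]].
- exact: ideal_mul_submodule.
- exists n, a, (f \o m); split=> //.
  by rewrite linear_sum; apply: eq_bigr => i _; rewrite linearZ.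
(* I R = I because I is also a right ideal and 1 is in R. *)
suff IR : @ideal_mul R I R^o = I by move=> M; rewrite IR.
apply/seteqP; split=> [_ [n [a [m [Ia ->]]]]|a Ia].
  have [I0 IZ] := (submoduleP _).1 hI.
  elim/big_ind: _ => // [x y Ix Iy|i _]; last exact: Ir.
  by rewrite -[x]scale1r; exact: IZ.
exists 1%N, (fun=> a), (fun=> 1); split=> //.
by rewrite big_ord1 [_ *: _]mulr1.
Qed.

Lemma T_class_quotient_closed (R : pzRingType)
    (sigma : forall M : lmodType R, set M) :
  preradical sigma -> quotient_closed (T_class sigma).
Proof.
move=> [_ sf] M N f fT MT; rewrite /T_class -subTset -fT => _ [x _ <-].
by apply: (sf _ _ f); exists x => //; rewrite MT.
Qed.

Lemma T_class_annihilator_outside (R : pzRingType) (D : module_class R)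
    (S : lmodType R) :
  left_perfect R -> quotient_closed D -> simple_module S ->
  T_class (@ideal_mul R (annihilator_outside D)) S <-> D S.
Proof.
move=> hR Dq Ssim; have [[s s0] Sgen] := Ssim; split=> [ST|DS].
  apply: contrapT => nDS; apply: s0.
  have [n [a [m [Ia ->]]]] :
      @ideal_mul R (annihilator_outside D) S s by rewrite ST.
  by apply: big1 => i _; exact: Ia.
have [r Ir rs] := annihilator_outside_fixes hR Dq Ssim DS s0.
rewrite /T_class -subTset => t _; have [a ->] := Sgen s t s0.
exists 1%N, (fun=> a * r), (fun=> s); split=> [_ S' s' S'sim nDS'|].
  by rewrite -scalerA (Ir _ _ S'sim nDS') scaler0.
by rewrite big_ord1 -scalerA rs.
Qed.

Theorem corollary4p24 (R : pzRingType) (hR : left_perfect R) :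
  forall C : module_class R,
    (exists sigma : (forall M : lmodType R, set M),
       t_radical sigma /\ same_class C (P_class sigma)) <->
    conatural C.
Proof.
move=> C; split=> [[sigma [[sp _] CP]]|[D [Dq CD]]].
  by exists (T_class sigma); split=> //; exact: T_class_quotient_closed.
pose I := annihilator_outside D.
have It : t_radical (@ideal_mul R I).
  apply: ideal_mul_t_radical => [|a b Ia S s Ssim nDS]; last first.
    by rewrite -scalerA Ia.
  apply/submoduleP; split=> [S s _ _|a x y Ix Iy S s Ssim nDS].
    exact: scale0r.
  by rewrite scalerDl -scalerA Ix // Iy // scaler0 addr0.
have Tq := T_class_quotient_closed It.1.
exists (@ideal_mul R I); split=> // M; rewrite CD.
split; apply: quotient_perp_determined_by_simples => // S Ssim.
  by move/(T_class_annihilator_outside hR Dq Ssim).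
by move=> DS; apply/(T_class_annihilator_outside hR Dq Ssim).
Qed.
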